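(* Let $R$ be a reduced Noetherian ring of characteristic $p > 0$, and let $*$ denote tight closure on $R$. Let $M$ be a finitely generated $R$-module. If an injective $R$-linear map $\alpha: R \to M$ sending $1 \mapsto u$ is $*$-phantom, then so is the map $\alpha': R \to \mathrm{Sym}^2(M)$ sending $1 \mapsto u \otimes u$. As a result, $*$ satisfies the Algebra Axiom.
   Context: All rings are commutative with unity. Tight closure: $R^\circ$ is the complement of the union of the minimal primes of $R$; $F^e$ is the $e$-th iterated Frobenius (Peskine-Szpiro) functor on $R$-modules, and for $u \in M$, $u^q$ denotes its image in $F^e(M)$, $q = p^e$. For finitely generated $R$-modules $N \subseteq M$, $u \in N_M^*$ if there is $c \in R^\circ$ such that $c u^q \in \mathrm{im}(F^e(N) \to F^e(M))$ for all sufficiently large $q = p^e$. Phantom extension: let $\mathrm{cl}$ be a closure operation on $R$ (such as $*$), $M$ a finitely generated $R$-module and $\alpha: R \to M$ an injective $R$-linear map with cokernel $Q$. Let $\epsilon \in \mathrm{Ext}^1_R(Q,R)$ correspond to $0 \to R \to M \to Q \to 0$. Then $\alpha$ is $\mathrm{cl}$-phantom if $\epsilon \in 0^{\mathrm{cl}}_{\mathrm{Ext}^1_R(Q,R)}$. Equivalently, if $P_\bullet$ is a projective resolution of $Q$ by finitely generated projectives and $\phi \in \mathrm{Hom}_R(P_1,R)$ is a cocycle representing $\epsilon$, then $\phi$ lies in the $\mathrm{cl}$-closure, in $\mathrm{Hom}_R(P_1,R)$, of the image of $\mathrm{Hom}_R(P_0,R) \to \mathrm{Hom}_R(P_1,R)$.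 Algebra Axiom for $\mathrm{cl}$: for every finitely generated $R$-module $M$, if $\alpha: R \to M$, $1 \mapsto e_1$, is $\mathrm{cl}$-phantom, then $\alpha': R \to \mathrm{Sym}^2(M)$, $1 \mapsto e_1 \otimes e_1$, is $\mathrm{cl}$-phantom. *)

(* Defs.v *)
From HB Require Import structures.
From mathcomp Require Import all_boot all_algebra.
From mathcomp Require Import boolp classical_sets.
From mathcomp.multinomials Require Import freeg.

Set Implicit Arguments.
Unset Strict Implicit.
Unset Printing Implicit Defensive.

Import GRing.Theory.
Local Open Scope ring_scope.
Local Open Scope quotient_scope.

Section Submodules.
Variable R : comNzRingType.

(* A submodule is a boolean predicate; any Prop-valued set of vectors closed
   under the operations becomes one through asbool. *)
Definition submod (V : lmodType R) (N : submodClosed V) : Type :=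
  {x : V | x \in (N : {pred V})}.

Section SubmodInstances.
Variables (V : lmodType R) (N : submodClosed V).
HB.instance Definition _ := SubChoice.on (submod N).
HB.instance Definition _ := [SubChoice_isSubLmodule of submod N by <:].
Definition submod_incl : submod N -> V := val.
Lemma submod_incl_is_linear : linear submod_incl.
Proof. by move=> a x y; rewrite /submod_incl linearP. Qed.
HB.instance Definition _ :=
  GRing.isLinear.Build R (submod N) V *:%R submod_incl submod_incl_is_linear.
End SubmodInstances.

Definition fin_gen (V : lmodType R) : Prop :=
  exists (n : nat) (g : 'I_n -> V),
    forall x, exists a : 'I_n -> R, x = \sum_(i < n) a i *: g i.

Section Span.
Variables (V : lmodType R) (A : set V).
Definition submod_span : {pred V} := fun x =>
  `[< exists (n : nat) (a : 'I_n -> R) (s : 'I_n -> V),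
        (forall i, A (s i)) /\ x = \sum_(i < n) a i *: s i >].
Lemma submod_span_closed : submod_closed submod_span.
Proof.
split.
  apply/asboolP; exists 0, (fun=> 0), (fun=> 0); split; first by case.
  by rewrite big_ord0.
move=> c x y /asboolP[n [a [s [As ->]]]] /asboolP[m [b [t [At ->]]]].
apply/asboolP; exists (n + m)%N.
exists (fun i => match split i with inl j => c * a j | inr j => b j end).
exists (fun i => match split i with inl j => s j | inr j => t j end).
split; first by move=> i; case: split.
rewrite big_split_ord /= scaler_sumr; congr (_ + _); apply: eq_bigr => i _.
  by rewrite (unsplitK (inl i)) scalerA.
by rewrite (unsplitK (inr i)).
Qed.
HB.instance Definition _ := GRing.isSubmodClosed.Build R V submod_span
  submod_span_closed.
Lemma mem_submod_span x : A x -> x \in submod_span.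
Proof.
move=> Ax; apply/asboolP; exists 1, (fun=> 1), (fun=> x); split=> //.
by rewrite big_ord1 scale1r.
Qed.
End Span.

Section Quotients.
Variables (V : lmodType R) (N : submodClosed V).

Definition quot_pred : {pred V} := N.
HB.instance Definition _ := GRing.isZmodClosed.Build V quot_pred
  (GRing.submod_closedB (submodClosedP N)).

Definition quotmod : Type := Quotient.quot quot_pred.
HB.instance Definition _ := GRing.Zmodule.on quotmod.
HB.instance Definition _ : EqQuotient V (Quotient.equiv quot_pred) quotmod :=
  EqQuotient.on quotmod.

Definition quot_proj (x : V) : quotmod := \pi_quotmod x.

Lemma quot_projP x y : quot_proj x = quot_proj y <-> x - y \in (N : {pred V}).
Proof.
by split=> [/eqmodP|H]; last apply/eqmodP.
Qed.
Lemma quot_projK (x : quotmod) : quot_proj (repr x) = x.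
Proof. exact: reprK. Qed.

Lemma quot_proj_is_zmod_morphism : zmod_morphism quot_proj.
Proof. exact: (raddfB (\pi_(Quotient.quot quot_pred))). Qed.
HB.instance Definition _ :=
  GRing.isZmodMorphism.Build V quotmod quot_proj quot_proj_is_zmod_morphism.

Definition quot_scale (a : R) (x : quotmod) : quotmod := quot_proj (a *: repr x).

Lemma quot_proj_scale a x : quot_scale a (quot_proj x) = quot_proj (a *: x).
Proof.
by apply/quot_projP; rewrite -scalerBr rpredZ //; apply/quot_projP; rewrite quot_projK.
Qed.

Lemma quot_scaleA a b x : quot_scale a (quot_scale b x) = quot_scale (a * b) x.
Proof. by rewrite -[x]quot_projK !quot_proj_scale scalerA. Qed.
Lemma quot_scale1 x : quot_scale 1 x = x.
Proof. by rewrite -[x]quot_projK !quot_proj_scale scale1r. Qed.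
Lemma quot_scaleDr a : {morph quot_scale a : x y / x + y}.
Proof.
move=> x y; rewrite -[x]quot_projK -[y]quot_projK -raddfD !quot_proj_scale -raddfD.
by rewrite scalerDr.
Qed.
Lemma quot_scaleDl x : {morph quot_scale^~ x : a b / a + b}.
Proof. by move=> a b; rewrite -[x]quot_projK !quot_proj_scale -raddfD scalerDl. Qed.
HB.instance Definition _ := GRing.Zmodule_isLmodule.Build R quotmod
  quot_scaleA quot_scale1 quot_scaleDr quot_scaleDl.

Lemma quot_proj_is_scalable : scalable quot_proj.
Proof. by move=> a x; rewrite -quot_proj_scale. Qed.
HB.instance Definition _ :=
  GRing.isScalable.Build R V quotmod *:%R quot_proj quot_proj_is_scalable.
End Quotients.

Section Image.
Variables (U V : lmodType R) (f : {linear U -> V}).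
Definition lin_im : {pred V} := fun y => `[< exists x, f x = y >].
Lemma lin_im_closed : submod_closed lin_im.
Proof.
split; first by apply/asboolP; exists 0; rewrite linear0.
move=> a _ _ /asboolP[x <-] /asboolP[y <-].
by apply/asboolP; exists (a *: x + y); rewrite linearP.
Qed.
HB.instance Definition _ := GRing.isSubmodClosed.Build R V lin_im lin_im_closed.
End Image.

Section Hom.
Variables U V : lmodType R.
Definition lin_hom : Type := {linear U -> V}.

HB.instance Definition _ := gen_eqMixin lin_hom.
HB.instance Definition _ := gen_choiceMixin lin_hom.

Lemma lin_homP (f g : lin_hom) : (f : U -> V) =1 g <-> f = g.
Proof.
split=> [|-> //] /funext; case: f g => [f cf] [g cg] /= fg; subst g.
congr GRing.Linear.Pack.
case: cf cg => [[[a0 aD]] [aZ]] [[[b0 bD]] [bZ]].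
by rewrite (Prop_irrelevance a0 b0) (Prop_irrelevance aD bD)
  (Prop_irrelevance aZ bZ).
Qed.

Definition lin_hom_zero : lin_hom := (\0 : {linear U -> V}).
Definition lin_hom_opp (f : lin_hom) : lin_hom := (\- f : {linear U -> V}).
Definition lin_hom_add (f g : lin_hom) : lin_hom := (f \+ g : {linear U -> V}).
Definition lin_hom_scale (a : R) (f : lin_hom) : lin_hom := (a \*: f : {linear U -> V}).
Lemma lin_hom_addA : associative lin_hom_add.
Proof. by move=> f g h; apply/lin_homP => x; rewrite /= addrA. Qed.
Lemma lin_hom_addC : commutative lin_hom_add.
Proof. by move=> f g; apply/lin_homP => x; rewrite /= addrC. Qed.
Lemma lin_hom_add0 : left_id lin_hom_zero lin_hom_add.
Proof. by move=> f; apply/lin_homP => x; rewrite /= add0r. Qed.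
Lemma lin_hom_addN : left_inverse lin_hom_zero lin_hom_opp lin_hom_add.
Proof. by move=> f; apply/lin_homP => x; rewrite /= addNr. Qed.
HB.instance Definition _ :=
  GRing.isZmodule.Build lin_hom lin_hom_addA lin_hom_addC lin_hom_add0 lin_hom_addN.
Lemma lin_hom_scaleA a b f : lin_hom_scale a (lin_hom_scale b f) = lin_hom_scale (a * b) f.
Proof. by apply/lin_homP => x; rewrite /= scalerA. Qed.
Lemma lin_hom_scale1 : left_id 1 lin_hom_scale.
Proof. by move=> f; apply/lin_homP => x; rewrite /= scale1r. Qed.
Lemma lin_hom_scaleDr : right_distributive lin_hom_scale +%R.
Proof. by move=> a f g; apply/lin_homP => x; rewrite /= scalerDr. Qed.
Lemma lin_hom_scaleDl f : {morph lin_hom_scale^~ f : a b / a + b}.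
Proof. by move=> a b; apply/lin_homP => x; rewrite /= scalerDl. Qed.
HB.instance Definition _ := GRing.Zmodule_isLmodule.Build R lin_hom
  lin_hom_scaleA lin_hom_scale1 lin_hom_scaleDr lin_hom_scaleDl.
End Hom.

Section Precomp.
Variables (U V W : lmodType R) (f : {linear U -> V}).
Definition precomp (g : lin_hom V W) : lin_hom U W := (g \o f : {linear U -> W}).
Lemma precomp_is_linear : linear precomp.
Proof. by move=> a g h; apply/lin_homP. Qed.
HB.instance Definition _ :=
  GRing.isLinear.Build R (lin_hom V W) (lin_hom U W) *:%R precomp precomp_is_linear.
End Precomp.

Section Line.
Variables (V : lmodType R) (v : V).
Definition line_map (r : R^o) : V := r *: v.
Lemma line_map_is_linear : linear line_map.
Proof. by move=> a r s; rewrite /line_map scalerDl scalerA. Qed.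
HB.instance Definition _ :=
  GRing.isLinear.Build R R^o V *:%R line_map line_map_is_linear.
End Line.

Section Tensor.
Variables U V : lmodType R.
Local Notation gen x y := (<< 1 *g (x, y) >> : {freeg (U * V) / R}).
Definition tensor_rel : set {freeg (U * V) / R} := fun z =>
  [\/ exists x x' y, z = gen (x + x') y - gen x y - gen x' y,
      exists x y y', z = gen x (y + y') - gen x y - gen x y',
      exists a x y, z = gen (a *: x) y - a *: gen x y
    | exists a x y, z = gen x (a *: y) - a *: gen x y].
Definition tensor : Type := quotmod (submod_span tensor_rel).
HB.instance Definition _ := GRing.Lmodule.on tensor.
Definition tens (x : U) (y : V) : tensor :=
  quot_proj (submod_span tensor_rel) (gen x y).
End Tensor.

Section Sym2.
Variable V : lmodType R.
Definition sym2_rel : set (tensor V V) := fun z =>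
  exists x y, z = tens x y - tens y x.
Definition sym2 : Type := quotmod (submod_span sym2_rel).
HB.instance Definition _ := GRing.Lmodule.on sym2.
Definition sym_tens (x y : V) : sym2 :=
  quot_proj (submod_span sym2_rel) (tens x y).
End Sym2.

Definition projective (P : lmodType R) : Prop :=
  forall (V W : lmodType R) (g : {linear V -> W}) (f : {linear P -> W}),
    (forall w, exists v, g v = w) ->
    exists h : {linear P -> V}, forall x, g (h x) = f x.

Record fg_proj_resolution (Q : lmodType R) := FgProjResolution {
  res_mod : nat -> lmodType R;
  res_diff : forall i, {linear res_mod i.+1 -> res_mod i};
  res_aug : {linear res_mod 0 -> Q};
  res_projective : forall i, projective (res_mod i);
  res_fin_gen : forall i, fin_gen (res_mod i);
  res_aug_surj : forall q, exists x, res_aug x = q;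
  res_exact0 : forall x, res_aug x = 0 <-> exists y, res_diff 0 y = x;
  res_exact : forall i x,
    res_diff i x = 0 <-> exists y, res_diff i.+1 y = x
}.

End Submodules.

Section BaseChange.
Variables (R S : comNzRingType) (phi : {rmorphism R -> S}).

Section Def.
Variable V : lmodType R.
Local Notation gen x := (<< 1 *g x >> : {freeg V / S}).
Definition base_change_rel : set {freeg V / S} := fun z =>
  (exists x y, z = gen (x + y) - gen x - gen y) \/
  (exists a x, z = gen (a *: x) - phi a *: gen x).
(* S ⊗_R V, with S an R-algebra through phi *)
Definition base_change : Type := quotmod (submod_span base_change_rel).
HB.instance Definition _ := GRing.Lmodule.on base_change.
Definition bc_tens (x : V) : base_change :=
  quot_proj (submod_span base_change_rel) (gen x).
End Def.

Lemma bc_tensD (V : lmodType R) :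
  {morph @bc_tens V : x y / x + y}.
Proof.
move=> x y; rewrite /bc_tens -raddfD; apply/quot_projP.
by rewrite opprD addrA; apply: mem_submod_span; left; exists x, y.
Qed.
Lemma bc_tensZ (V : lmodType R) a (x : V) :
  bc_tens (a *: x) = phi a *: bc_tens x.
Proof.
rewrite /bc_tens -linearZ; apply/quot_projP.
by apply: mem_submod_span; right; exists a, x.
Qed.

Section Map.
Variables (U V : lmodType R) (f : {linear U -> V}).
Definition bc_map_free (z : {freeg U / S}) : base_change V :=
  fglift (fun x => bc_tens (f x)) z.
Lemma bc_map_free_is_zmod_morphism : zmod_morphism bc_map_free.
Proof. exact: lift_is_additive. Qed.
HB.instance Definition _ := GRing.isZmodMorphism.Build {freeg U / S}
  (base_change V) bc_map_free bc_map_free_is_zmod_morphism.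
Lemma bc_map_freeE a x : bc_map_free << a *g x >> = a *: bc_tens (f x).
Proof. exact: liftU. Qed.
Lemma bc_map_free_is_scalable : scalable bc_map_free.
Proof.
move=> a z; rewrite -[z in RHS]freeg_sumE {1}/GRing.scale /= /fgscale.
rewrite !raddf_sum; apply: eq_bigr => x _ /=.
by rewrite !bc_map_freeE scalerA.
Qed.
HB.instance Definition _ := GRing.isScalable.Build S {freeg U / S}
  (base_change V) *:%R bc_map_free bc_map_free_is_scalable.
Lemma bc_map_free0 z : z \in submod_span (@base_change_rel U) -> bc_map_free z = 0.
Proof.
have mE x : bc_map_free << 1 *g x >> = bc_tens (f x).
  by rewrite bc_map_freeE scale1r.
move=> /asboolP[n [a [s [rel_s ->]]]].
rewrite linear_sum big1 // => i _; rewrite linearZ /=.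
suff -> : bc_map_free (s i) = 0 by rewrite scaler0.
have [[x [y ->]]|[b [x ->]]] := rel_s i.
  by rewrite !raddfB /= !mE linearD bc_tensD addrAC addrK subrr.
by rewrite raddfB /= linearZ /= !mE [f _]linearZ bc_tensZ subrr.
Qed.
Definition bc_map (z : base_change U) : base_change V := bc_map_free (repr z).
Lemma bc_map_proj z : bc_map (quot_proj _ z) = bc_map_free z.
Proof.
apply/eqP; rewrite -subr_eq0 -raddfB /=.
by apply/eqP/bc_map_free0/quot_projP; rewrite quot_projK.
Qed.
Lemma bc_map_is_linear : linear bc_map.
Proof.
move=> a x y; rewrite -[x]quot_projK -[y]quot_projK -linearP !bc_map_proj.
exact: linearP.
Qed.
HB.instance Definition _ := GRing.isLinear.Build S (base_change U)
  (base_change V) *:%R bc_map bc_map_is_linear.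
Lemma bc_mapE x : bc_map (bc_tens x) = bc_tens (f x).
Proof. by rewrite /bc_tens bc_map_proj bc_map_freeE scale1r. Qed.
End Map.
End BaseChange.

Section Char_p.
Variables (R : comNzRingType) (p : nat) (charRp : p \in [pchar R]) (e : nat).

Definition iter_frob : R -> R := iter e (pFrobenius_aut charRp).

Lemma iter_frobE x : iter_frob x = x ^+ (p ^ e).
Proof.
rewrite /iter_frob; elim: e => [|k IHk]; first by rewrite expn0 expr1.
by rewrite iterS IHk pFrobenius_autE -exprM expnSr.
Qed.
Lemma iter_frob_is_zmod_morphism : zmod_morphism iter_frob.
Proof.
rewrite /iter_frob => x y; elim: e => //= k ->; exact: rmorphB.
Qed.
Lemma iter_frob_is_monoid_morphism : monoid_morphism iter_frob.
Proof.
split=> [|x y]; rewrite !iter_frobE; [exact: expr1n | exact: exprMn].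
Qed.
HB.instance Definition _ :=
  GRing.isZmodMorphism.Build R R iter_frob iter_frob_is_zmod_morphism.
HB.instance Definition _ :=
  GRing.isMonoidMorphism.Build R R iter_frob iter_frob_is_monoid_morphism.

(* F^e(M), the map F^e(f), and u^q as an element of F^e(M), for q = p ^ e. *)
Definition frob (M : lmodType R) : lmodType R := base_change iter_frob M.
Definition frob_map (M N : lmodType R) (f : {linear M -> N}) :
  {linear frob M -> frob N} := bc_map f.
Definition frob_elt (M : lmodType R) (u : M) : frob M := bc_tens iter_frob u.
End Char_p.

Section RingConditions.
Variable R : comNzRingType.

Definition noetherian : Prop := forall I : submodClosed R^o, fin_gen (submod I).

Definition reduced_ring : Prop :=
  forall (x : R) (n : nat), x ^+ n = 0 -> x = 0.

Definition minimal_prime (P : prime_idealr R) : Prop :=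
  forall P' : prime_idealr R, {subset P' <= P} -> {subset P <= P'}.

(* R° *)
Definition ring_circ : set R := fun c =>
  forall P : prime_idealr R, minimal_prime P -> c \notin P.
End RingConditions.

Section Closures.
Variable R : comNzRingType.

(* cl M N is the closure of the submodule N in M *)
Definition closure_family : Type :=
  forall M : lmodType R, submodClosed M -> set M.

Definition tight_closure (p : nat) (charRp : p \in [pchar R]) :
    closure_family := fun M N u =>
  exists2 c, ring_circ c &
    exists e0, forall e, (e0 <= e)%N ->
      c *: frob_elt charRp e u \in lin_im (frob_map charRp e (@submod_incl R M N)).

Section Phantom.
Variables (cl : closure_family) (M : lmodType R) (alpha : {linear R^o -> M}).

Definition coker : lmodType R := quotmod (lin_im alpha).

(* (g, phi) lifts the identity of the cokernel to a map of complexes from the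
   resolution to 0 -> R -> M -> coker -> 0, so the class of phi in
   Ext^1(coker, R) is that of the extension. Since alpha is injective, phi is
   automatically a cocycle; and every representing cocycle arises from some g. *)
Definition represents_ext (P : fg_proj_resolution coker)
    (phi : lin_hom (res_mod P 1) R^o) : Prop :=
  exists g : {linear res_mod P 0 -> M},
    (forall x, quot_proj (lin_im alpha) (g x) = res_aug P x) /\
    (forall y, alpha (phi y) = g (res_diff P 0 y)).

(* The closure is taken in the ambient module Hom(P_1, R): for tight closure,
   this is weaker than asking that the class lie in the closure of 0 in the
   abstract module Ext^1(coker, R). For instance k[t^2,t^3] -> k[t] is phantom
   here, whereas 0 is closed in Ext^1(k, k[t^2,t^3]) = k. *)
Definition phantom_ext : Prop :=
  injective alpha /\
  forall (P : fg_proj_resolution coker) (phi : lin_hom (res_mod P 1) R^o),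
    represents_ext phi ->
    @cl (lin_hom (res_mod P 1) R^o) (lin_im (precomp (res_diff P 0))) phi.
End Phantom.

Definition algebra_axiom (cl : closure_family) : Prop :=
  forall (M : lmodType R) (alpha : {linear R^o -> M}),
    fin_gen M -> phantom_ext cl alpha ->
    phantom_ext cl (line_map (sym_tens (alpha 1) (alpha 1))).
End Closures.

(* Main.v *)
From HB Require Import structures.
Require Import Defs.
From mathcomp Require Import all_boot all_algebra.
From mathcomp Require Import boolp classical_sets.
From mathcomp.multinomials Require Import freeg.
Import GRing.Theory.
Local Open Scope ring_scope.

Set Implicit Arguments.
Unset Strict Implicit.
Unset Printing Implicit Defensive.

(** Write q = p ^ e, and let F_*^e R be R viewed as a module over itself through
    the e-th iterated Frobenius; a linear map M -> F_*^e R is thus an additive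
    map gamma : M -> R with gamma (r m) = r^q gamma m. The proof rests on a
    characterization of phantom extensions: an injective alpha : R -> M,
    1 |-> u, is phantom for tight closure if and only if there is c in R° such
    that, for all large e, some gamma : M -> F_*^e R satisfies gamma u = c
    (phantom_retract and retract_phantom).

    The statement about Sym^2 is immediate from this: if gamma u = c, then
    m (x) n |-> gamma m * gamma n is a symmetric bilinear map to F_*^e R, hence
    induces a linear map on Sym^2(M) that sends u (x) u to c^2, and c^2 is again
    in R°. Moreover R -> Sym^2(M) is injective: if r (u (x) u) = 0 then
    r^q c^2 = 0, and in a reduced ring the elements of R° are nonzerodivisors,
    so that r^q = 0 and r = 0.

    For the characterization, let P be a resolution of coker alpha by finitely
    generated projectives, with differential d : P_1 -> P_0, and let phi
    represent the extension. Both sides are compared with the condition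
      (E)  some linear psi : P_0 -> F_*^e R satisfies psi (d y) = c phi(y)^q.
    Dual bases of P_0 and P_1 show that (E) says exactly that c phi^q lies in the
    image of F^e of the coboundaries in F^e(Hom(P_1, R))
    (frobenius_image_extends and extends_frobenius_image). On the other hand M
    is the pushout of R and P_0 along phi and d, up to signs, so that psi
    and r |-> c r^q glue to a map gamma on M with gamma u = c, and
    conversely gamma restricts to P_0 (extends_retract and retract_extends).
    As being phantom quantifies over all resolutions, using it requires that
    there be one; this is where R being Noetherian and M finitely
    generated enter (free_resolution). *)

(** * Universal properties of quotients, free modules, Sym^2 and base change *)

(** The bundled linear map with underlying function f. *)
Definition linear_of (R : comNzRingType) (U V : lmodType R) (f : U -> V)
  (f_linear : linear f) : {linear U -> V} :=
  HB.pack f (GRing.isLinear.Build R U V *:%R f f_linear).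

Section QuotientLift.
Variable R : comNzRingType.

Lemma quot_lift (V W : lmodType R) (N : submodClosed V) (f : {linear V -> W}) :
    (forall x, x \in (N : {pred V}) -> f x = 0) ->
  exists g : {linear quotmod N -> W}, forall x, g (quot_proj N x) = f x.
Proof.
move=> fN0; pose g (z : quotmod N) := f (repr z).
have gE x : g (quot_proj N x) = f x.
  apply/eqP; rewrite -subr_eq0 -raddfB; apply/eqP/fN0.
  by apply/quot_projP; rewrite quot_projK.
have gL : linear g.
  move=> a x y; rewrite -[x]quot_projK -[y]quot_projK -linearP !gE.
  exact: linearP.
by exists (linear_of gL).
Qed.

Lemma span_lift (V W : lmodType R) (A : set V) (f : {linear V -> W}) :
    (forall x, A x -> f x = 0) ->
  exists g : {linear quotmod (submod_span A) -> W},
    forall x, g (quot_proj (submod_span A) x) = f x.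
Proof.
move=> fA0; apply: quot_lift => _ /asboolP[n [a [s [As ->]]]].
by rewrite linear_sum big1 // => i _; rewrite linearZ fA0 //= scaler0.
Qed.

Section FreegLift.
Variables (K : choiceType) (W : lmodType R) (f : K -> W).

(** The linear extension of f to the free module on K. *)
Definition freeg_ext (z : {freeg K / R}) : W := fglift f z.

Lemma freeg_ext_is_zmod_morphism : zmod_morphism freeg_ext.
Proof. exact: lift_is_additive. Qed.
HB.instance Definition _ := GRing.isZmodMorphism.Build {freeg K / R} W
  freeg_ext freeg_ext_is_zmod_morphism.

Lemma freeg_ext_is_scalable : scalable freeg_ext.
Proof.
move=> a z; rewrite -[z in RHS]freeg_sumE {1}/GRing.scale /= /fgscale.
rewrite !raddf_sum; apply: eq_bigr => x _ /=.
by rewrite /freeg_ext !liftU scalerA.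
Qed.
HB.instance Definition _ := GRing.isScalable.Build R {freeg K / R} W *:%R
  freeg_ext freeg_ext_is_scalable.

Lemma freeg_lift :
  exists g : {linear {freeg K / R} -> W}, forall x, g << 1 *g x >> = f x.
Proof. by exists freeg_ext => x; rewrite /= /freeg_ext liftU scale1r. Qed.
End FreegLift.

(** A symmetric bilinear map factors through the symmetric square. *)
Lemma sym2_lift (V W : lmodType R) (b : V -> V -> W) :
    (forall y, linear (b^~ y)) -> (forall x, linear (b x)) ->
    (forall x y, b x y = b y x) ->
  exists g : {linear sym2 V -> W}, forall x y, g (sym_tens x y) = b x y.
Proof.
move=> bl br bC.
have blD x x' y : b (x + x') y = b x y + b x' y.
  exact: (raddfD (linear_of (bl y))).
have brD x y y' : b x (y + y') = b x y + b x y'.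
  exact: (raddfD (linear_of (br x))).
have blZ a x y : b (a *: x) y = a *: b x y.
  exact: (linearZ_LR (linear_of (bl y))).
have brZ a x y : b x (a *: y) = a *: b x y.
  exact: (linearZ_LR (linear_of (br x))).
have [f fE] := freeg_lift (fun xy : V * V => b xy.1 xy.2).
have [|t tE] := @span_lift _ W (@tensor_rel R V V) f.
  move=> _ [[x [x' [y ->]]]|[x [y [y' ->]]]|[a [x [y ->]]]|[a [x [y ->]]]].
  - by rewrite !raddfB /= !fE /= blD addrAC addrK subrr.
  - by rewrite !raddfB /= !fE /= brD addrAC addrK subrr.
  - by rewrite raddfB /= [X in _ - X]linearZ /= !fE /= blZ subrr.
  - by rewrite raddfB /= [X in _ - X]linearZ /= !fE /= brZ subrr.
have {}tE x y : t (tens x y) = b x y by rewrite tE fE.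
have [|s sE] := @span_lift _ W (@sym2_rel R V) t.
  by move=> _ [x [y ->]]; rewrite raddfB /= !tE bC subrr.
by exists s => x y; rewrite sE tE.
Qed.
End QuotientLift.

Section Restriction.
Variables (R S : comNzRingType) (phi : {rmorphism R -> S}).

(** S as an R-module through phi: a in R acts as multiplication by phi a. The
    argument phi is a dummy that selects this structure on the type S. *)
Definition restrict_scalars & {rmorphism R -> S} : Type := S.
Local Notation phiS := (restrict_scalars phi).
HB.instance Definition _ := GRing.Zmodule.on phiS.

Definition restrict_scale (a : R) (x : phiS) : phiS := phi a * (x : S).
Lemma restrict_scaleA a b x :
  restrict_scale a (restrict_scale b x) = restrict_scale (a * b) x.
Proof. by rewrite /restrict_scale rmorphM mulrA. Qed.
Lemma restrict_scale1 : left_id 1 restrict_scale.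
Proof. by move=> x; rewrite /restrict_scale rmorph1 mul1r. Qed.
Lemma restrict_scaleDr : right_distributive restrict_scale +%R.
Proof. by move=> a x y; rewrite /restrict_scale mulrDr. Qed.
Lemma restrict_scaleDl x : {morph restrict_scale^~ x : a b / a + b}.
Proof. by move=> a b; rewrite /restrict_scale rmorphD mulrDl. Qed.
HB.instance Definition _ := GRing.Zmodule_isLmodule.Build R phiS
  restrict_scaleA restrict_scale1 restrict_scaleDr restrict_scaleDl.

Lemma restrict_scaleE a (x : phiS) : a *: x = phi a * (x : S) :> S.
Proof. by []. Qed.

(** Extension of scalars is left adjoint to restriction of scalars, for maps
    to S itself. *)
Lemma base_change_lift (V : lmodType R) (f : {linear V -> phiS}) :
  exists g : {linear base_change phi V -> S^o},
    forall x, g (bc_tens phi x) = f x.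
Proof.
have [h hE] := freeg_lift (f : V -> S^o).
have [|g gE] := @span_lift S _ S^o (@base_change_rel R S phi V) h.
  move=> _ [[x [y ->]]|[a [x ->]]].
    by rewrite !raddfB /= !hE raddfD /= addrAC addrK subrr.
  by rewrite raddfB /= [X in _ - X]linearZ /= !hE [f _]linearZ subrr.
by exists g => x; rewrite gE hE.
Qed.

Lemma base_change_ind (V : lmodType R) (P : base_change phi V -> Prop) :
    P 0 -> (forall a x z, P z -> P (a *: bc_tens phi x + z)) ->
  forall z, P z.
Proof.
move=> P0 PD z; rewrite -[z]quot_projK -[repr z]freeg_sumE raddf_sum /=.
elim: (dom _) => [|x s IHs]; first by rewrite big_nil.
rewrite big_cons.
suff -> (a : S) : << a *g x >> = a *: << 1 *g x >> :> {freeg V / S}.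
  by rewrite linearZ; exact: PD.
apply/eqP/freeg_eqP => y; rewrite coeff_fgscale !coeffU.
by rewrite mul1r.
Qed.

Lemma bc_tens_lincomb (V : lmodType R) n (a : 'I_n -> R) (x : 'I_n -> V) :
  bc_tens phi (\sum_i a i *: x i) = \sum_i phi (a i) *: bc_tens phi (x i).
Proof.
have bc0 : bc_tens phi (0 : V) = 0.
  by apply: (addrI (bc_tens phi 0)); rewrite -bc_tensD !addr0.
rewrite (big_morph _ (@bc_tensD R S phi V) bc0).
by apply: eq_bigr => i _; rewrite bc_tensZ.
Qed.
End Restriction.

(** * Dual bases and free resolutions *)

Section Resolutions.
Variable R : comNzRingType.

Lemma rV_comb_is_linear (V : lmodType R) n (v : 'I_n -> V) :
  linear (fun x : 'rV[R]_n => \sum_i x 0 i *: v i).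
Proof.
move=> a x y; rewrite scaler_sumr -big_split; apply: eq_bigr => i _ /=.
by rewrite !mxE scalerDl scalerA.
Qed.

(** The map R^n -> V that sends the i-th basis vector to v i. *)
Definition rV_comb (V : lmodType R) n (v : 'I_n -> V) : {linear 'rV[R]_n -> V} :=
  linear_of (rV_comb_is_linear v).

Lemma projective_rV n : projective ('rV[R]_n : lmodType R).
Proof.
move=> V W g f g_surj.
have [v vE] := choice (fun i => g_surj (f (delta_mx 0 i))).
exists (rV_comb v) => x; rewrite {2}[x]row_sum_delta /= !linear_sum.
by apply: eq_bigr => i _; rewrite !linearZ /= vE.
Qed.

Lemma fin_gen_rV n : fin_gen ('rV[R]_n : lmodType R).
Proof.
exists n, (delta_mx 0) => x; exists (x 0); exact: row_sum_delta.
Qed.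

Lemma dual_basis (P : lmodType R) : projective P -> fin_gen P ->
  exists n (x : 'I_n -> P) (xs : 'I_n -> lin_hom P R^o),
    forall v, v = \sum_i xs i v *: x i.
Proof.
move=> projP [n [x x_gen]].
have [|h hE] := projP _ _ (rV_comb x) (idfun : {linear P -> P}).
  move=> v; have [a vE] := x_gen v; exists (\row_i a i).
  by rewrite /= vE; apply: eq_bigr => i _; rewrite mxE.
have hL i : linear (fun v => h v 0 i : R^o).
  by move=> a v w; rewrite linearP !mxE.
exists n, x, (fun i => linear_of (hL i)) => v.
by rewrite -{1}[v]hE.
Qed.

(** The submodule of R^n generated by the rows of B. *)
Definition row_space k n (B : 'M[R]_(k, n)) : set 'rV[R]_n :=
  fun x => exists y : 'rV_k, x = y *m B.

Lemma row_mx0_rsubmx n (v : 'rV[R]_(1 + n)) :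
  v 0 0 = 0 -> v = row_mx 0 (rsubmx v).
Proof.
move=> v0; rewrite -{1}[v]hsubmxK; congr row_mx.
by apply/rowP => j; rewrite !mxE -[RHS]v0 ord1; congr (v _ _); apply/val_inj.
Qed.

(** Over a Noetherian ring, every submodule of R^n is generated by the rows of a matrix. *)
Lemma noetherian_rV n (N : set 'rV[R]_n) :
    noetherian R -> N 0 -> (forall a x y, N x -> N y -> N (a *: x + y)) ->
  exists k (B : 'M[R]_(k, n)), forall x, N x <-> row_space B x.
Proof.
(* Induction on n: N is an extension of the ideal I of first coordinates of its
   elements by the submodule N' of its elements whose first coordinate is 0. *)
move=> noethR; elim: n N => [|n IHn] N N0 NP.
  exists 0, 0 => x; rewrite [x]thinmx0; split=> // _.
  by exists 0; rewrite mul0mx.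
have NZ a x : N x -> N (a *: x) by move=> Nx; rewrite -[_ *: _]addr0; exact: NP.
have ND x y : N x -> N y -> N (x + y).
  by move=> Nx Ny; rewrite -[x]scale1r; exact: NP.
pose N' : set 'rV[R]_n := fun x => N (row_mx (0 : 'rV_1) x).
have [||k' [B' B'E]] := IHn N'.
- by rewrite /N' row_mx0.
- move=> a x y Nx Ny; rewrite /N'.
  suff -> : row_mx (0 : 'rV_1) (a *: x + y) = a *: row_mx 0 x + row_mx 0 y.
    exact: NP.
  by rewrite scale_row_mx add_row_mx scaler0 addr0.
pose I : set R^o := fun a => exists2 x, N x & x 0 0 = a.
have [r [g gE]] := noethR (submod_span I).
have memI a : a \in submod_span I -> I a.
  move=> /asboolP[m [b [s [Is ->]]]].
  elim/big_ind: _ => [|x y [v Nv <-] [w Nw <-]|i _].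
  - by exists 0 => //; rewrite mxE.
  - by exists (v + w); [exact: ND | rewrite mxE].
  - by have [v Nv <-] := Is i; exists (b i *: v); [exact: NZ | rewrite mxE].
have [w wE] : exists w : 'I_r -> 'rV[R]_n.+1,
    forall i, N (w i) /\ w i 0 0 = val (g i).
  have [i|w wE] := choice (P := fun i x => N x /\ x 0 0 = val (g i)).
    by have [x Nx xE] := memI _ (valP (g i)); exists x.
  by exists w.
pose W : 'M[R]_(r, 1 + n) := \matrix_i w i.
pose B0 : 'M[R]_(k', 1 + n) := row_mx 0 B'.
have B0E (z : 'rV_k') : z *m B0 = row_mx (0 : 'rV_1) (z *m B').
  by rewrite mul_mx_row mulmx0.
exists (r + k')%N, (col_mx W B0) => x.
have rowE y : y *m W = \sum_i y 0 i *: w i.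
  by rewrite mulmx_sum_row; apply: eq_bigr => i _; rewrite rowK.
have NW y : N (y *m W).
  by rewrite rowE; elim/big_ind: _ => // i _; apply: NZ; case: (wE i).
split=> [Nx|[y ->]]; last first.
  rewrite -[y]hsubmxK mul_row_col; apply: ND => //.
  by rewrite B0E; apply/B'E; exists (rsubmx y).
have Ix : x 0 0 \in submod_span I by apply: mem_submod_span; exists x.
have [a aE] := gE (Sub (x 0 0) Ix).
pose y := \row_i a i.
have xyE : (x - y *m W) 0 0 = 0.
  have /= := congr1 (@submod_incl _ _ (submod_span I)) aE.
  rewrite linear_sum /= {1}/submod_incl SubK => xE.
  rewrite !mxE xE -sumrB big1 // => i _.
  by rewrite !mxE (wE i).2 linearZ subrr.
have xyE' := row_mx0_rsubmx xyE.
have /B'E [z zE] : N' (rsubmx (x - y *m W : 'rV_(1 + n))).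
  by rewrite /N' -xyE'; rewrite addrC -scaleN1r; exact: NP.
exists (row_mx y z); rewrite mul_row_col B0E -zE -xyE'.
by rewrite addrC subrK.
Qed.

(** Multiplication by B as a map R^k -> R^n of row vectors. *)
Definition mx_map k n (B : 'M[R]_(k, n)) : {linear 'rV[R]_k -> 'rV[R]_n} :=
  mulmxr B.

Lemma noetherian_syzygies k n (A : 'M[R]_(k, n)) : noetherian R ->
  exists r (B : 'M[R]_(r, k)), forall x : 'rV_k, x *m A = 0 <-> row_space B x.
Proof.
move=> noethR; apply: noetherian_rV => //; first by rewrite mul0mx.
by move=> a x y xA0 yA0; rewrite mulmxDl -scalemxAl xA0 yA0 scaler0 addr0.
Qed.

(** A matrix together with its dimensions, so that matrices of varying sizes can
    be iterated over: in a free resolution, the rows of each matrix generate the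
    syzygies of the rows of the previous one. *)
Record presentation := Presentation {
  pres_rels : nat; pres_gens : nat; pres_mx : 'M[R]_(pres_rels, pres_gens)
}.

Lemma free_resolution (Q : lmodType R) : noetherian R -> fin_gen Q ->
  inhabited (fg_proj_resolution Q).
Proof.
move=> noethR [n [g g_gen]].
have [r0 [A0 A0E]] : exists r (B : 'M[R]_(r, n)),
    forall x, rV_comb g x = 0 <-> row_space B x.
  apply: noetherian_rV => //; first by rewrite linear0.
  by move=> a x y x0 y0; rewrite linearP x0 y0 scaler0 addr0.
have syz (T : presentation) : {B : {r & 'M[R]_(r, pres_rels T)} |
    forall x, x *m pres_mx T = 0 <-> row_space (projT2 B) x}.
  apply: cid; have [r [B BE]] := noetherian_syzygies (pres_mx T) noethR.
  by exists (existT _ r B).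
(* The number of generators of the module presented by S i.+1 is by definition the
   number of relations of S i, so that consecutive matrices are composable. *)
pose S i := iter i (fun T => Presentation (projT2 (sval (syz T)))) (Presentation A0).
pose F i : lmodType R := 'rV[R]_(pres_gens (S i)).
pose d i : {linear F i.+1 -> F i} := mx_map (pres_mx (S i)).
constructor; apply: (@FgProjResolution R Q F d (rV_comb g)).
- by move=> i; exact: projective_rV.
- by move=> i; exact: fin_gen_rV.
- move=> q; have [a ->] := g_gen q; exists (\row_i a i).
  by apply: eq_bigr => i _; rewrite mxE.
- by move=> x; rewrite A0E; split=> -[y yE]; exists y.
- by move=> i x; rewrite [d i x]/= (svalP (syz (S i))); split=> -[y yE]; exists y.
Qed.
End Resolutions.

(** * Frobenius functionals and the tight closure of the coboundaries *)

Lemma lin_hom_sumE (R : comNzRingType) (U V : lmodType R) n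
    (f : 'I_n -> lin_hom U V) (x : U) :
  (\sum_i f i : lin_hom U V) x = \sum_i f i x.
Proof. exact: (big_morph (fun g : lin_hom U V => g x)). Qed.

Section FrobeniusFunctionals.
Variables (R : comNzRingType) (p : nat) (charRp : p \in [pchar R]).

(** F_*^e R: the ring R, with a acting as multiplication by a ^ (p ^ e). *)
Definition frob_push (e : nat) : lmodType R :=
  restrict_scalars (iter_frob charRp e).

Lemma restrict_functional_is_linear e (P : lmodType R) (h : {linear P -> R^o}) :
  linear (fun v => iter_frob charRp e (h v) : frob_push e).
Proof. by move=> a v w; rewrite linearP rmorphD rmorphM. Qed.

Lemma eval_frob_is_linear e (P : lmodType R) (y : P) :
  linear (fun h : lin_hom P R^o => iter_frob charRp e (h y) : frob_push e).
Proof. by move=> a h k; rewrite rmorphD rmorphM. Qed.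

Lemma scaled_frob_is_linear e (P : lmodType R) (c : R) (f : {linear P -> frob_push e}) :
  linear (fun v => c * (f v : R) : frob_push e).
Proof.
move=> a v w; rewrite linearP mulrDr; congr (_ + _).
by rewrite restrict_scaleE mulrCA.
Qed.

Section Cocycle.
Variables (P0 P1 : lmodType R) (d : {linear P1 -> P0}) (phi : lin_hom P1 R^o).
Variables (c : R) (e : nat).

(** c phi^q belongs to the image of F^e(B) in F^e(Hom(P1, R)), where B is the
    module of the coboundaries h o d with h : P0 -> R. *)
Definition in_frobenius_image : Prop :=
  c *: frob_elt charRp e phi
    \in lin_im (frob_map charRp e (@submod_incl R _ (lin_im (precomp (W := R^o) d)))).

(** The q-th power of phi, multiplied by c, is the composite with d of a
    functional on P0 that is linear along the Frobenius. *)
Definition extends_frobenius_power : Prop :=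
  exists psi : {linear P0 -> frob_push e},
    forall y, psi (d y) = c * iter_frob charRp e (phi y) :> R.

Lemma frobenius_image_extends : in_frobenius_image -> extends_frobenius_power.
Proof.
move=> /asboolP[z zE].
(* Evaluation at y, h |-> h(y)^q, as a linear form on F^e(Hom(P1, R)). *)
have /choice[ev evE] (y : P1) :=
  base_change_lift (linear_of (eval_frob_is_linear e y)).
pose G (z : frob charRp e (submod (lin_im (precomp (W := R^o) d)))) :=
  exists psi : {linear P0 -> frob_push e}, forall y,
    psi (d y) = ev y (frob_map charRp e (@submod_incl R _ _) z) :> R.
have [psi psiE] : G z.
  elim/base_change_ind: z {zE} => [|a h z [psi psiE]].
    by exists (\0 : {linear _ -> _}) => y; rewrite !linear0.
  have /asboolP[k kE] := valP h.
  exists (linear_of (scaled_frob_is_linear a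
    (linear_of (restrict_functional_is_linear e k))) \+ psi : {linear _ -> _}).
  move=> y; rewrite /= psiE !linearP /=; congr (_ + _).
  by rewrite [in RHS]bc_mapE evE /= -[submod_incl h]kE.
exists psi => y; rewrite psiE zE linearZ.
by congr (_ * _); exact: evE.
Qed.

Lemma extends_frobenius_image :
    projective P0 -> fin_gen P0 -> projective P1 -> fin_gen P1 ->
  extends_frobenius_power -> in_frobenius_image.
Proof.
move=> proj0 fg0 proj1 fg1 [psi psiE].
have [n [x [xs xE]]] := dual_basis proj0 fg0.
have [m [y [ys yE]]] := dual_basis proj1 fg1.
(* h is the combination of the dual basis ys with coefficients h (y j), and the
   Frobenius raises these coefficients to the power q. *)
have frobE (h : lin_hom P1 R^o) : frob_elt charRp e h =
    \sum_j iter_frob charRp e (h (y j)) *: frob_elt charRp e (ys j).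
  rewrite -bc_tens_lincomb; congr bc_tens.
  suff hE : h = \sum_j (h (y j) : R) *: ys j by rewrite {1}hE.
  apply/lin_homP => v; rewrite {1}[v]yE linear_sum lin_hom_sumE.
  by apply: eq_bigr => j _; rewrite linearZ; exact: mulrC.
pose pull i : lin_hom P1 R^o := precomp d (xs i).
have pull_im i : pull i \in lin_im (precomp (W := R^o) d).
  by apply/asboolP; exists (xs i).
pose s i : submod (lin_im (precomp (W := R^o) d)) :=
  exist _ (pull i) (pull_im i).
(* As psi is the combination of the (xs i)^q with coefficients psi (x i), c phi^q
   should be that of the (xs i o d)^q. *)
apply/asboolP; exists (\sum_i (psi (x i) : R) *: frob_elt charRp e (s i)).
rewrite linear_sum /= [in RHS]frobE scaler_sumr.
transitivity (\sum_i \sum_j ((psi (x i) : R) * iter_frob charRp e (pull i (y j))) *: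
    frob_elt charRp e (ys j)).
  apply: eq_bigr => i _; rewrite linearZ /= bc_mapE -/(frob_elt charRp e (pull i)).
  rewrite frobE scaler_sumr.
  by apply: eq_bigr => j _; rewrite scalerA.
rewrite exchange_big; apply: eq_bigr => j _ /=.
rewrite -scaler_suml scalerA -psiE; congr (_ *: _).
rewrite [in RHS](xE (d (y j))) linear_sum; apply: eq_bigr => i _.
by rewrite linearZ; exact: mulrC.
Qed.
End Cocycle.
End FrobeniusFunctionals.

(** * Elements outside the minimal primes of a reduced ring *)

Section MinimalPrimes.
Local Open Scope classical_set_scope.
Variable R : comNzRingType.
Hypothesis R_reduced : reduced_ring R.

(** Multiplicatively closed sets that contain 1 but not 0. *)
Definition mult_set (S : set R) : Prop :=
  [/\ S 1, ~ S 0 & forall x y, S x -> S y -> S (x * y)].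

Section Complement.
Variable S : set R.
Hypotheses (S_mult : mult_set S)
  (S_max : forall T, mult_set T -> S `<=` T -> T `<=` S).

(** By maximality, the set of all s x^n with s in S contains 0 when x is not in
    S; reducedness then brings the exponent down to 1. *)
Lemma max_mult_setN x : ~ S x <-> exists2 s, S s & s * x = 0.
Proof.
have [S1 S0 SM] := S_mult; split=> [Sx|[s Ss sx0] Sx]; last first.
  by apply: S0; rewrite -sx0; exact: SM.
apply: contrapT => sx_neq0; apply: Sx.
pose T : set R := fun y => exists2 s, S s & exists n, y = s * x ^+ n.
have : T `<=` S.
  apply: S_max; last by move=> s Ss; exists s => //; exists 0; rewrite mulr1.
  split.
  - by exists 1 => //; exists 0; rewrite mulr1.
  - move=> [s Ss [n sx0]]; apply: sx_neq0; exists s => //.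
    apply: (@R_reduced _ n.+1).
    by rewrite exprMn exprSr [x ^+ _.+1]exprS mulrACA -sx0 mulr0.
  - move=> _ _ [s Ss [n ->]] [t St [m ->]]; exists (s * t); first exact: SM.
    by exists (n + m)%N; rewrite exprD mulrACA.
by apply; exists 1 => //; exists 1; rewrite mul1r.
Qed.

(** The complement of S, as a boolean predicate. *)
Definition mult_compl : {pred R} := fun x => `[< ~ S x >].

Lemma mult_compl_idealr : idealr_closed mult_compl.
Proof.
have [S1 S0 SM] := S_mult; split; first exact/asboolP.
  by apply/negP => /asboolP.
move=> a u v /asboolP/max_mult_setN[s Ss su0] /asboolP/max_mult_setN[t St tv0].
apply/asboolP/max_mult_setN; exists (s * t); first exact: SM.
by rewrite mulrDr -[s * t * v]mulrA tv0 mulr0 addr0 [s * t]mulrC mulrACA su0 mulr0.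
Qed.

Lemma mult_compl_prime : prime_idealr_closed mult_compl.
Proof.
have [_ _ SM] := S_mult.
move=> u v /asboolP Suv; apply/orP; apply: contrapT => /not_orP[Su Sv].
apply: Suv; apply: SM; apply: contrapT => SN.
  by apply: Su; exact/asboolP.
by apply: Sv; exact/asboolP.
Qed.

(** The complement of a maximal multiplicative set, as a prime ideal. *)
Definition mult_compl_ideal : prime_idealr R :=
  HB.pack mult_compl (isIdealr.Build R mult_compl mult_compl_idealr)
    (isPrimeIdealrClosed.Build R mult_compl mult_compl_prime).

Lemma mem_mult_compl x : x \in mult_compl_ideal <-> ~ S x.
Proof. by split => [/asboolP|Sx]; last exact/asboolP. Qed.

Lemma mult_compl_minimal : minimal_prime mult_compl_ideal.
Proof.
move=> P sub x /mem_mult_compl/max_mult_setN[s Ss sx0].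
have : s * x \in P by rewrite sx0 rpred0.
by rewrite prime_idealrM => /orP[/sub/mem_mult_compl|].
Qed.
End Complement.

(** The minimal primes of a reduced ring meet in 0: the complement of a maximal
    multiplicative set that contains r is a minimal prime. *)
Lemma minimal_prime_avoids r : r <> 0 ->
  exists2 P : prime_idealr R, minimal_prime P & r \notin P.
Proof.
move=> r_neq0.
(* The empty set is admitted because the union of an empty chain is empty. *)
pose Z (S : set R) := S = set0 \/ mult_set S /\ S r.
have [F FZ F_tot|S [ZS S_max]] := @Zorn_bigcup R Z.
  have [[S [FS Sr]]|noS] := pselect (exists S, F S /\ S r); last first.
    left; apply/seteqP; split=> // x [S FS Sx].
    have [S0|[_ Sr]] := FZ _ FS; first by rewrite S0 in Sx.
    by case: noS; exists S.
  have Fmult T x : F T -> T x -> mult_set T.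
    by move=> FT Tx; have [T0|[]//] := FZ _ FT; rewrite T0 in Tx.
  have [S1 S0 SM] := Fmult _ _ FS Sr.
  right; split; last by exists S.
  split; first by exists S.
    by move=> [T FT T0]; have [_ /(_ T0)] := Fmult _ _ FT T0.
  move=> x y [T FT Tx] [U FU Uy]; have [TU|UT] := F_tot _ _ FT FU.
    by exists U => //; have [_ _ UM] := Fmult _ _ FU Uy; apply: UM => //; exact: TU.
  by exists T => //; have [_ _ TM] := Fmult _ _ FT Tx; apply: TM => //; exact: UT.
have {}S_max T : Z T -> S `<=` T -> T `<=` S.
  move=> ZT ST; apply: contrapT => TS; apply: (S_max T) ZT; split=> //.
have powZ : Z (fun x => exists n, x = r ^+ n).
  right; split; last by exists 1; rewrite expr1.
  split; first by exists 0.
    by move=> [n /esym/R_reduced].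
  by move=> _ _ [n ->] [m ->]; exists (n + m)%N; rewrite exprD.
have [S_mult Sr] : mult_set S /\ S r.
  case: ZS => // S0; have := S_max _ powZ; rewrite S0 => /(_ _)/(_ r)[] //.
  by exists 1; rewrite expr1.
have {}S_max T : mult_set T -> S `<=` T -> T `<=` S.
  by move=> Tm ST; apply: S_max => //; right; split=> //; exact: ST.
exists (mult_compl_ideal S_mult S_max); first exact: mult_compl_minimal.
by apply/negP => /mem_mult_compl.
Qed.

Lemma ring_circ_regular (c r : R) : ring_circ c -> c * r = 0 -> r = 0.
Proof.
move=> c_circ cr0; apply: contrapT => /minimal_prime_avoids[P Pmin rP].
have : c * r \in P by rewrite cr0 rpred0.
by rewrite prime_idealrM (negbTE rP) orbF (negbTE (c_circ _ Pmin)).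
Qed.

Lemma ring_circM (c d : R) :
  ring_circ c -> ring_circ d -> ring_circ (c * d).
Proof.
by move=> cc dc P Pmin; rewrite prime_idealrM negb_or cc ?dc.
Qed.
End MinimalPrimes.

(** * Phantom extensions as extensions split up to c by Frobenius functionals *)

Section Phantom.
Variables (R : comNzRingType) (p : nat) (charRp : p \in [pchar R]).
Variables (M : lmodType R) (alpha : {linear R^o -> M}).
Local Notation frob_push := (frob_push charRp).

(** The map R -> F_*^e R, r |-> c r^q, factors through alpha. *)
Definition frobenius_retract (c : R) (e : nat) : Prop :=
  exists gamma : {linear M -> frob_push e}, gamma (alpha 1) = c :> R.

Lemma linear_from_ring (r : R) : alpha r = r *: alpha 1.
Proof. by rewrite -linearZ; congr (alpha _); rewrite [RHS]mulr1. Qed.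

Lemma fin_gen_coker : fin_gen M -> fin_gen (coker alpha).
Proof.
move=> [n [g g_gen]]; exists n, (fun i => quot_proj (lin_im alpha) (g i)) => x.
have [a aE] := g_gen (repr x); exists a.
rewrite -[x]quot_projK aE linear_sum; apply: eq_bigr => i _.
by rewrite linearZ.
Qed.

Section Represented.
Variables (P : fg_proj_resolution (coker alpha)) (phi : lin_hom (res_mod P 1) R^o).

Lemma retract_extends c e : represents_ext phi -> frobenius_retract c e ->
  extends_frobenius_power charRp (res_diff P 0) phi c e.
Proof.
move=> [g [_ gd]] [gamma gammaE].
exists (gamma \o g : {linear _ -> _}) => y; rewrite /= -gd linear_from_ring linearZ.
by rewrite gammaE; exact: mulrC.
Qed.

Lemma extends_retract c e : injective alpha -> represents_ext phi ->
  extends_frobenius_power charRp (res_diff P 0) phi c e -> frobenius_retract c e.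
Proof.
move=> alpha_inj [g [g_aug gd]] [psi psiE].
have decomp m : exists rx : R * res_mod P 0, m = alpha rx.1 + g rx.2.
  have [x xE] := res_aug_surj P (quot_proj (lin_im alpha) m).
  have /asboolP[r rE] : m - g x \in lin_im alpha.
    by apply/quot_projP; rewrite g_aug.
  by exists (r, x); rewrite /= rE subrK.
(* G r x is the value to be given to alpha r + g x. *)
pose G (r : R) x : frob_push e := c * iter_frob charRp e r + (psi x : R).
have GP a r x s y : G (a * r + s) (a *: x + y) = a *: G r x + G s y.
  rewrite /G [psi _]linearP rmorphD rmorphM mulrDr addrACA; congr (_ + _).
  by rewrite scalerDr; congr (_ + _); rewrite mulrCA.
have G_wd r x s y : alpha r + g x = alpha s + g y -> G r x = G s y.
  move=> eq_rs; have /res_exact0[z zE] : res_aug P (x - y) = 0.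
    rewrite -g_aug; apply/eqP; rewrite -[0](raddf0 (quot_proj (lin_im alpha))).
    apply/eqP/quot_projP; rewrite subr0; apply/asboolP; exists (s - r).
    by rewrite !linearB /=; apply/eqP; rewrite subr_eq addrAC eq_sym subr_eq addrC eq_rs addrC.
  have sE : s = r + phi z.
    apply: alpha_inj; rewrite linearD /= gd zE linearB /=.
    by rewrite addrA eq_rs addrK.
  by rewrite /G sE rmorphD mulrDr -psiE zE linearB /= -addrA subrK.
have [rx rxE] := choice decomp.
have gammaL : linear (fun m => G (rx m).1 (rx m).2).
  move=> a m n; rewrite -GP; apply: G_wd; rewrite -rxE !linearP /=.
  by rewrite {1}[m]rxE {1}[n]rxE scalerDr addrACA.
exists (linear_of gammaL); rewrite /=.
rewrite (G_wd _ _ 1 0) -?rxE ?linear0 ?addr0 // /G.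
by rewrite linear0 rmorph1 mulr1 addr0.
Qed.

(** Membership of phi in the tight closure of the coboundaries, unfolded. *)
Lemma tight_closure_coboundaries :
  @tight_closure R p charRp (lin_hom (res_mod P 1) R^o)
     (lin_im (precomp (res_diff P 0))) phi <->
  exists2 c, ring_circ c & exists e0, forall e, (e0 <= e)%N ->
    in_frobenius_image charRp (res_diff P 0) phi c e.
Proof. by []. Qed.
End Represented.

(** The class of the extension is represented by a cocycle on every resolution. *)
Lemma represented_exists (P : fg_proj_resolution (coker alpha)) :
  injective alpha -> exists phi, @represents_ext R M alpha P phi.
Proof.
move=> alpha_inj.
have [|g g_aug] := @res_projective R _ P 0 M _
    (quot_proj (lin_im alpha) : {linear M -> coker alpha}) (res_aug P).
  by move=> w; exists (repr w); rewrite /= quot_projK.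
have gd y : exists r, alpha r = g (res_diff P 0 y).
  suff /asboolP : g (res_diff P 0 y) \in lin_im alpha by [].
  rewrite -[g _]subr0; apply/quot_projP.
  by rewrite raddf0 [LHS]g_aug; apply/res_exact0; exists y.
have [phi phiE] := choice gd.
have phiL : linear (phi : _ -> R^o).
  by move=> a x y; apply: alpha_inj; rewrite linearP /= !phiE !linearP.
by exists (linear_of phiL), g; split.
Qed.

Lemma phantom_retract : noetherian R -> fin_gen M ->
    phantom_ext (tight_closure charRp) alpha ->
  exists2 c, ring_circ c & exists e0, forall e, (e0 <= e)%N ->
    frobenius_retract c e.
Proof.
move=> noethR fgM [alpha_inj phantom].
have [P] := free_resolution noethR (fin_gen_coker fgM).
have [phi phi_rep] := represented_exists P alpha_inj.
have /tight_closure_coboundaries[c cR [e0 ce]] := phantom P phi phi_rep.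
exists c => //; exists e0 => e /ce/frobenius_image_extends.
exact: extends_retract.
Qed.

Lemma retract_phantom : injective alpha ->
    (exists2 c, ring_circ c & exists e0, forall e, (e0 <= e)%N ->
      frobenius_retract c e) ->
  phantom_ext (tight_closure charRp) alpha.
Proof.
move=> alpha_inj [c cR [e0 ce]]; split=> // P phi phi_rep.
apply/tight_closure_coboundaries; exists c => //; exists e0 => e /ce c_retract.
apply: extends_frobenius_image; do ?[exact: res_projective | exact: res_fin_gen].
exact: retract_extends.
Qed.
End Phantom.

(** * The symmetric square *)

Lemma frobenius_retract_sym2 (R : comNzRingType) (p : nat)
    (charRp : p \in [pchar R]) (M : lmodType R) (alpha : {linear R^o -> M}) c e :
  frobenius_retract charRp alpha c e ->
  frobenius_retract charRp (line_map (sym_tens (alpha 1) (alpha 1))) (c * c) e.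
Proof.
move=> [gamma gammaE].
pose b x y : frob_push charRp e := (gamma x : R) * gamma y.
have bC x y : b x y = b y x by exact: mulrC.
have br x : linear (b x).
  move=> a y z; rewrite /b [in LHS]linearP mulrDr; congr (_ + _).
  exact: mulrCA.
have bl y : linear (b^~ y) by move=> a x z; rewrite ![b _ y]bC br.
have [g gE] := sym2_lift bl br bC.
by exists g; rewrite /= /line_map scale1r gE /b gammaE.
Qed.

Lemma retract_injective (R : comNzRingType) (p : nat)
    (charRp : p \in [pchar R]) (M : lmodType R) (alpha : {linear R^o -> M}) c e :
  reduced_ring R -> ring_circ c -> frobenius_retract charRp alpha c e ->
  injective alpha.
Proof.
move=> R_reduced c_circ [gamma gammaE] r s /eqP.
rewrite -subr_eq0 -linearB linear_from_ring => /eqP rs0.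
have : gamma ((r - s) *: alpha 1) = 0 by rewrite rs0 linear0.
rewrite linearZ gammaE => /esym; rewrite -[LHS]/(0 : R) => /esym rsc.
have {}rsc : c * (r - s) ^+ (p ^ e) = 0.
  by rewrite -(iter_frobE charRp) mulrC; exact: rsc.
have /R_reduced := ring_circ_regular R_reduced c_circ rsc.
by move/eqP; rewrite subr_eq0 => /eqP.
Qed.

Theorem proposition3p6 (R : comNzRingType) (p : nat) (charRp : p \in [pchar R])
    (R_reduced : reduced_ring R) (R_noetherian : noetherian R) :
  (forall (M : lmodType R) (alpha : {linear R^o -> M}) (u : M),
      fin_gen M -> alpha 1 = u -> injective alpha ->
      phantom_ext (tight_closure charRp) alpha ->
      phantom_ext (tight_closure charRp) (line_map (sym_tens u u)))
  /\ algebra_axiom (tight_closure charRp).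
Proof.
suff sym2_phantom : algebra_axiom (tight_closure charRp).
  by split=> // M alpha u fgM <- _; exact: sym2_phantom.
move=> M alpha fgM /(phantom_retract R_noetherian fgM)[c c_circ [e0 c_retract]].
have cc_retract e : (e0 <= e)%N -> frobenius_retract charRp
    (line_map (sym_tens (alpha 1) (alpha 1))) (c * c) e.
  by move=> /c_retract; exact: frobenius_retract_sym2.
have cc_circ := ring_circM c_circ c_circ.
apply: retract_phantom; last by exists (c * c) => //; exists e0.
exact: retract_injective R_reduced cc_circ (cc_retract e0 (leqnn e0)).
Qed.
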